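(* Let $\alpha>0$, let $r=-(\alpha+1)-\sqrt{\alpha+1}$ and $s=-(\alpha+1)+\sqrt{\alpha+1}$, and define polynomials $$v_2(x)=\tfrac12(x-r)(x-s)+x-r-\sqrt{\alpha+1}\ \bigl(=L_2^{\alpha}(-x)\bigr),\qquad v_3(x)=(x-r)^2(x-s+1),$$ $$v_k(x)=(x-r)^{\lceil k/2\rceil}(x-s)^{\lfloor k/2\rfloor}\quad (k\ge 4).$$ Then the sequence $\{v_2,v_3,v_4,\ldots\}$ forms a flag for the Type I $X_2$ exceptional Laguerre differential expression $\widehat\ell_2^{I,\alpha}$.
   Context: $L_n^{\beta}(x)=\sum_{i=0}^n \binom{n+\beta}{n-i}\frac{(-x)^i}{i!}$ denotes the classical Laguerre polynomial of degree $n$ with parameter $\beta$. The numbers $r$ and $s$ are the two roots of $L_2^{\alpha-1}(-x)=\tfrac12x^2+(\alpha+1)x+\tfrac{\alpha(\alpha+1)}2=\tfrac12(x-r)(x-s)$. The Type I $X_2$ exceptional Laguerre differential expression is $$\widehat\ell_2^{I,\alpha}[y](x)=-xy''(x)+\left(x-\alpha-1+2x\,\frac{\left(L_2^{\alpha-1}(-x)\right)'}{L_2^{\alpha-1}(-x)}\right)y'(x)+\left(2\alpha\,\frac{\left(L_2^{\alpha-1}(-x)\right)'}{L_2^{\alpha-1}(-x)}-2\right)y(x),$$ where the prime denotes $d/dx$. A sequence of polynomials $\{v_2,v_3,\ldots\}$ with $\deg v_k=k$ is called a flag for $\widehat\ell_2^{I,\alpha}$ if its span is preserved by the operator, in the sense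 that for every $k\ge2$ the space $\operatorname{span}\{v_2,\ldots,v_k\}$ is mapped into itself by $\widehat\ell_2^{I,\alpha}$ (in particular $\widehat\ell_2^{I,\alpha}[v]$ is a polynomial for each $v$ in this span). *)

(* Defs.v *)
From HB Require Import structures.
From mathcomp Require Import all_boot all_order all_algebra.
From mathcomp Require Import all_classical all_reals all_analysis.
Set Implicit Arguments.
Unset Strict Implicit.
Unset Printing Implicit Defensive.
Import Order.TTheory GRing.Theory Num.Theory.
Import numFieldNormedType.Exports.
Local Open Scope classical_set_scope.
Local Open Scope ring_scope.

(* x (x - 1) ... (x - m + 1) / m!, the binomial coefficient with a real
   upper entry. *)
Definition gbinom (R : realType) (x : R) (m : nat) : R :=
  (\prod_(j < m) (x - j%:R)) / (m`!)%:R.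

Definition laguerre (R : realType) (n : nat) (beta : R) : {poly R} :=
  \sum_(i < n.+1)
    (gbinom (n%:R + beta) (n - i) / (i`!)%:R) *: (- 'X) ^+ i.

(* x |-> L_2^(alpha - 1)(- x) *)
Definition X2_den (R : realType) (alpha : R) : R -> R :=
  fun x => (laguerre 2 (alpha - 1)).[- x].

(* Only meaningful at the points where X2_den alpha does not vanish, since
   division by zero returns zero. *)
Definition X2_expr (R : realType) (alpha : R) (y : R -> R) : R -> R :=
  let q := X2_den alpha in
  fun x =>
    - x * derive1n 2 y x
    + (x - alpha - 1 + 2 * x * (derive1 q x / q x)) * derive1 y x
    + (2 * alpha * (derive1 q x / q x) - 2) * y x.

(* The linear span of v_2, ..., v_k. *)
Definition span_from2 (R : realType) (v : nat -> {poly R}) (k : nat) :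
    set {poly R} :=
  [set p | exists c : nat -> R, p = \sum_(2 <= i < k.+1) c i *: v i].

(* The sequence v_2, v_3, ... is a flag for a differential expression T with
   rational coefficients whose poles lie outside the cofinite set D: T p is
   the polynomial w when the two agree on D.  The values v 0 and v 1 are never
   used.  Recall that size p is the degree of p plus one. *)
Definition is_flag (R : realType) (D : set R) (T : (R -> R) -> (R -> R))
    (v : nat -> {poly R}) : Prop :=
  (forall k, (2 <= k)%N -> size (v k) = k.+1) /\
  (forall k, (2 <= k)%N -> forall p, span_from2 v k p ->
     exists2 w, span_from2 v k w & forall x, D x -> T (horner p) x = w.[x]).

Definition root_r (R : realType) (alpha : R) : R :=
  - (alpha + 1) - Num.sqrt (alpha + 1).

Definition root_s (R : realType) (alpha : R) : R :=
  - (alpha + 1) + Num.sqrt (alpha + 1).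

(* uphalf k is the ceiling of k / 2 and k./2 its floor. *)
Definition X2_flag (R : realType) (alpha : R) (k : nat) : {poly R} :=
  let r := root_r alpha in
  let s := root_s alpha in
  if k == 2%N then
    2^-1 *: (('X - r%:P) * ('X - s%:P)) + 'X - r%:P
      - (Num.sqrt (alpha + 1))%:P
  else if k == 3%N then ('X - r%:P) ^+ 2 * ('X - s%:P + 1)
  else ('X - r%:P) ^+ uphalf k * ('X - s%:P) ^+ k./2.

(* Main.v *)
Require Import Defs.
From mathcomp Require Import all_boot all_order all_algebra.
From mathcomp Require Import all_classical all_reals all_analysis.
From mathcomp Require Import ring lra zify.
Import Order.TTheory GRing.Theory Num.Theory.
Local Open Scope classical_set_scope.
Local Open Scope ring_scope.

(** The span of v_2, ..., v_k is identified with a space that the expression T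
    visibly preserves.  Write q = L_2^(alpha-1)(-x) = (x - r)(x - s) / 2 and
    t = sqrt (alpha + 1), so that r = -t^2 - t and s = -t^2 + t.  For a
    polynomial p, q T[p] is a polynomial ([X2_num]), and for c = r or c = s its
    value at c is q'(c) times 2 (c p'(c) + alpha p(c)).  Hence T[p] is a
    polynomial when

      c p'(c) + alpha p(c) = 0   for c = r and c = s                  (1)

    ([X2_num_root]).  The key fact is that T[p] then satisfies (1) again
    ([apparent_at_stable]).  The singular points c are apparent: the indicial
    exponents of T at c are 0 and 3, which makes p'''(c) disappear from the
    two-term Taylor expansion of T[p] at c, and what is left of
    c T[p]'(c) + alpha T[p](c) is a multiple of the left-hand side of (1).
    Since T does not raise the degree, it preserves the space E_k of the
    polynomials of degree at most k that satisfy (1).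

    Finally E_k is the span of v_2, ..., v_k ([span_X2_flag]): each v_k has
    degree k and satisfies (1), so subtracting a multiple of v_k leads from E_k
    to E_(k-1), down to E_1 = 0, where (1) forces the two coefficients to
    vanish. *)

(** * Degree bounds *)

Lemma size_mul_leq_add {R : nzRingType} {p q : {poly R}} {m n : nat} :
  (size p <= m.+1)%N -> (size q <= n)%N -> (size (p * q)%R <= m + n)%N.
Proof. by move=> hp hq; apply: leq_trans (size_polyMleq _ _) _; lia. Qed.

Lemma size_add_leq {R : nzRingType} {p q : {poly R}} {n : nat} :
  (size p <= n)%N -> (size q <= n)%N -> (size (p + q)%R <= n)%N.
Proof.
by move=> hp hq; apply: leq_trans (size_polyD _ _) _; rewrite geq_max hp hq.
Qed.

Lemma size_deriv_leq {R : nzRingType} {p : {poly R}} {n : nat} :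
  (size p <= n.+1)%N -> (size p^`() <= n)%N.
Proof.
move=> hp; have [->|p0] := eqVneq p 0; first by rewrite deriv0 size_poly0.
by have := lt_size_deriv p0; lia.
Qed.

(** * The differential expression on polynomials *)

Lemma half_polyC (R : realType) : (2^-1)%:P * 2%:R = 1 :> {poly R}.
Proof. by rewrite -polyC_natr -polyCM mulVf ?pnatr_eq0. Qed.

Lemma laguerre2_oppX (R : realType) (beta : R) :
  laguerre 2 beta \Po (- 'X) =
  2^-1 *: 'X^2 + (beta + 2) *: 'X + ((beta + 1) * (beta + 2) / 2)%:P.
Proof.
rewrite /laguerre !big_ord_recl big_ord0 /= /gbinom.
rewrite !big_ord_recl !big_ord0 /= /bump /= !factS fact0.
rewrite !rmorphD /= !linearZ /= !rmorphXn /= !rmorphN /= comp_polyX rmorph0.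
rewrite opprK -!mul_polyC.
have -> : (2%:R + beta - 0%:R) * ((2%:R + beta - (1 + 0)%:R) * 1) /
   (2 * (1 * 1))%:R / 1%:R = (beta + 1) * (beta + 2) / 2 :> R by field.
have -> : (2%:R + beta - 0%:R) * 1 / (1 * 1)%:R / (1 * 1)%:R = beta + 2 :> R
  by field.
have -> : 1 / 1%:R / (2 * (1 * 1))%:R = 2^-1 :> R by field.
by rewrite expr0 expr1 mulr1; ring.
Qed.

Definition X2_denp {R : realType} (alpha : R) : {poly R} :=
  laguerre 2 (alpha - 1) \Po (- 'X).

(** The product of the denominator with the image of p under the differential
    expression. *)
Definition X2_num {R : realType} (alpha : R) (p : {poly R}) : {poly R} :=
  let q := X2_denp alpha in
  - ('X * q * p^`()^`())
  + (('X - (alpha + 1)%:P) * q + 2 *: ('X * q^`())) * p^`()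
  + ((2 * alpha) *: q^`() - 2 *: q) * p.

Lemma X2_denE (R : realType) (alpha : R) :
  X2_den alpha = horner (X2_denp alpha).
Proof. by apply/funext => x; rewrite /X2_den horner_comp !hornerE. Qed.

Lemma X2_denp_factor (R : realType) (alpha t : R) : t ^+ 2 = alpha + 1 ->
  X2_denp alpha =
  2^-1 *: (('X - (- (alpha + 1) - t)%:P) * ('X - (- (alpha + 1) + t)%:P)).
Proof.
move=> ht; rewrite /X2_denp laguerre2_oppX.
have -> : alpha = t ^+ 2 - 1 by rewrite ht addrK.
rewrite -!mul_polyC.
have -> : ((t ^+ 2 - 1 - 1 + 1) * (t ^+ 2 - 1 - 1 + 2) / 2)%:P =
  (2^-1)%:P * ((t ^+ 2 - 1)%:P * (t ^+ 2)%:P) :> {poly R}.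
  by rewrite -!polyCM; congr (_%:P); field.
have -> : (t ^+ 2 - 1 - 1 + 2)%:P =
  (2^-1)%:P * ((t ^+ 2)%:P * 2%:R) :> {poly R}.
  by rewrite mulrCA half_polyC mulr1; congr (_%:P); ring.
by ring.
Qed.

Lemma X2_denp_size (R : realType) (alpha : R) :
  0 < alpha -> size (X2_denp alpha) = 3.
Proof.
move=> a0; have ht : Num.sqrt (alpha + 1) ^+ 2 = alpha + 1.
  by rewrite sqr_sqrtr //; lra.
rewrite (X2_denp_factor _ _ _ ht).
by rewrite size_scale ?invr_eq0 ?pnatr_eq0 // size_mul ?polyXsubC_eq0 //
     !size_XsubC.
Qed.

Lemma X2_exprE (R : realType) (alpha : R) (p : {poly R}) (x : R) :
  X2_den alpha x != 0 ->
  X2_expr alpha (horner p) x = (X2_num alpha p).[x] / (X2_denp alpha).[x].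
Proof.
rewrite /X2_expr /X2_num X2_denE /derive1n /= -!derivE => q0.
by rewrite !hornerE /=; field.
Qed.

(** * The condition at the singular points *)

(** The values of q, q' and q'' at a root of q.  A root is written
    -(alpha + 1) - t where t is either square root of alpha + 1, so that r and
    s are treated at once. *)
Lemma X2_denp_jet (R : realType) (alpha t c : R) :
  t ^+ 2 = alpha + 1 -> c = - (alpha + 1) - t ->
  [/\ (X2_denp alpha).[c] = 0, (X2_denp alpha)^`().[c] = - t
    & (X2_denp alpha)^`()^`() = 1].
Proof.
move=> ht hc; rewrite (X2_denp_factor _ _ _ ht) hc; split.
- by rewrite !hornerE /=; ring.
- by rewrite !poly.derivE !hornerE /=; field.
rewrite !poly.derivE -!mul_polyC.
by rewrite -[RHS]half_polyC; ring.
Qed.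

(** At a root c of the denominator, this is the condition for the image of p to
    have no pole at c. *)
Definition apparent_at {R : realType} (alpha c : R) (p : {poly R}) : Prop :=
  c * p^`().[c] + alpha * p.[c] = 0.

(** Only the terms with q' survive at c, and they add up to
    2 q'(c) (c p'(c) + alpha p(c)). *)
Lemma X2_num_root (R : realType) (alpha t c : R) (p : {poly R}) :
  t ^+ 2 = alpha + 1 -> c = - (alpha + 1) - t ->
  apparent_at alpha c p -> root (X2_num alpha p) c.
Proof.
move=> ht hc hp; have [q0 q1 _] := X2_denp_jet _ _ _ _ ht hc.
rewrite rootE /X2_num !hornerE q0 q1; apply/eqP.
transitivity (- (2 * t) * (c * p^`().[c] + alpha * p.[c])).
  by rewrite /=; ring.
by rewrite hp mulr0.
Qed.

(** The first and second derivatives at c of w q = X2_num alpha p determine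
    w(c) and w'(c), because q'(c) = -t is not zero.  In the second one the
    terms in p'''(c) coming from - x q p'' and 2 x q' p' cancel, and so do the
    terms in p''(c) in the combination c w'(c) + alpha w(c). *)
Lemma apparent_at_stable (R : realType) (alpha t c : R) (p w : {poly R}) :
  0 < alpha -> t ^+ 2 = alpha + 1 -> c = - (alpha + 1) - t ->
  apparent_at alpha c p -> w * X2_denp alpha = X2_num alpha p ->
  apparent_at alpha c w.
Proof.
move=> a0 ht hc hp hw; have [q0 q1 q2] := X2_denp_jet _ _ _ _ ht hc.
have t0 : t != 0 by rewrite -sqrf_eq0 ht gt_eqF //; lra.
have t1 : t + 1 != 0.
  apply/eqP => /eqP; rewrite addr_eq0 => /eqP te.
  by move: ht; rewrite te => ht; lra.
have E1 := congr1 (fun f => f^`().[c]) hw.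
have E2 := congr1 (fun f => f^`()^`().[c]) hw.
rewrite /apparent_at in hp *.
move: E1 E2; rewrite /X2_num.
set q := X2_denp alpha in q0 q1 q2 *.
rewrite !(derivD, derivM, derivN, derivZ, derivX, derivC, derivB, q2).
rewrite !hornerE q0 q1 /=.
move: (p.[c]) (p^`().[c]) (p^`()^`().[c]) (p^`()^`()^`().[c])
  (p^`()^`()^`()^`().[c]) (w.[c]) (w^`().[c]) (w^`()^`().[c]) hp
  => p0 p1 p2 p3 p4 w0 w1 w2 hp E1 E2.
have ea : alpha = t ^+ 2 - 1 by rewrite ht addrK.
have ec : c = - (t * (t + 1)) by rewrite hc -ht; ring.
(* As alpha = (t - 1)(t + 1) and c = - t (t + 1), the condition on p says that
   p0 and p1 are proportional to t and t - 1. *)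
have p1E : p1 = (t - 1) * (p0 / t).
  apply: (mulfI (mulf_neq0 t0 t1)).
  have -> : t * (t + 1) * ((t - 1) * (p0 / t)) = (t ^+ 2 - 1) * p0 by field.
  by rewrite -ea; move: hp; rewrite ec; lra.
have p0E : p0 = t * (p0 / t) by field.
move: (p0 / t) p1E p0E => u p1E p0E; subst p0 p1.
(* The factors of E1 and E2 below are those for which the left-hand sides add
   up to 2 t^2 (c w1 + alpha w0). *)
have t2 : 2 * t ^+ 2 != 0 by rewrite mulf_neq0 ?pnatr_eq0 ?expf_neq0.
apply: (mulfI t2).
move: (congr1 ( *%R (- (t * (t + 1) * (2 * t - 3)))) E1).
move: (congr1 ( *%R (t ^+ 2 * (t + 1))) E2).
rewrite ec ea; lra.
Qed.

(** * The invariant spaces *)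

Definition X2_space {R : realType} (alpha : R) (k : nat) (p : {poly R}) :
    Prop :=
  [/\ (size p <= k.+1)%N, apparent_at alpha (root_r alpha) p
    & apparent_at alpha (root_s alpha) p].

Lemma sqrt_alpha1 (R : realType) (alpha : R) : 0 < alpha ->
  [/\ Num.sqrt (alpha + 1) ^+ 2 = alpha + 1,
    (- Num.sqrt (alpha + 1)) ^+ 2 = alpha + 1
    & 0 < Num.sqrt (alpha + 1)].
Proof.
by move=> a0; rewrite sqrrN sqr_sqrtr ?sqrtr_gt0; first split=> //; lra.
Qed.

Lemma root_sE (R : realType) (alpha : R) :
  root_s alpha = - (alpha + 1) - - Num.sqrt (alpha + 1).
Proof. by rewrite opprK. Qed.

Lemma X2_num_size (R : realType) (alpha : R) (k : nat) (p : {poly R}) :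
  0 < alpha -> (size p <= k.+1)%N -> (size (X2_num alpha p) <= k.+3)%N.
Proof.
move=> a0 hp.
have hq : (size (X2_denp alpha) <= 3)%N by rewrite X2_denp_size.
have hX : (size ('X : {poly R}) <= 2)%N by rewrite size_polyX.
have hXc : (size ('X - (alpha + 1)%:P : {poly R})%R <= 2)%N.
  by rewrite size_XsubC.
have hq1 := size_deriv_leq hq; have hp1 := size_deriv_leq hp.
rewrite /X2_num; apply: size_add_leq; first apply: size_add_leq.
- rewrite size_polyN.
  (* For constant p the bound k - 1 on the size of p'' is not available. *)
  case: k hp hp1 => [|k] hp hp1.
    have -> : p^`() = 0 by apply/eqP; rewrite -size_poly_leq0.
    by rewrite deriv0 mulr0 size_poly0.
  have := size_mul_leq_add (size_mul_leq_add hX hq) (size_deriv_leq hp1).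
  by move/leq_trans; apply; lia.
- apply: leq_trans (size_mul_leq_add (m := 3) _ hp1) _; last by lia.
  apply: size_add_leq; first exact: size_mul_leq_add hXc hq.
  apply: leq_trans (size_scale_leq _ _) _.
  by apply: leq_trans (size_mul_leq_add hX hq1) _.
- apply: leq_trans (size_mul_leq_add (m := 2) _ hp) _; last by lia.
  apply: size_add_leq; last first.
    by rewrite size_polyN (leq_trans (size_scale_leq _ _)).
  by apply: leq_trans (size_scale_leq _ _) _; apply: leq_trans hq1 _.
Qed.

Lemma X2_space_stable (R : realType) (alpha : R) (k : nat) (p : {poly R}) :
  0 < alpha -> X2_space alpha k p ->
  exists2 w, X2_space alpha k w & w * X2_denp alpha = X2_num alpha p.
Proof.
move=> a0 [hk hr hs]; have [ht htN t0] := sqrt_alpha1 _ _ a0.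
have hdvd : X2_denp alpha %| X2_num alpha p.
  rewrite (X2_denp_factor _ _ _ ht) dvdpZl ?invr_eq0 ?pnatr_eq0 //.
  rewrite Gauss_dvdp; last by apply: coprimep_XsubC2; lra.
  rewrite !dvdp_XsubCl (X2_num_root _ _ _ _ _ ht (erefl _) hr).
  exact: X2_num_root htN (root_sE _ _) hs.
have hw := divpK hdvd; exists (X2_num alpha p %/ X2_denp alpha) => //.
split.
- rewrite size_divp ?X2_denp_size //.
    by rewrite leq_subLR; exact: X2_num_size a0 hk.
  by rewrite -size_poly_eq0 X2_denp_size.
- exact: apparent_at_stable a0 ht (erefl _) hr hw.
- exact: apparent_at_stable a0 htN (root_sE _ _) hs hw.
Qed.

Lemma apparent_at_lin (R : realType) (alpha c a b : R) (p q : {poly R}) :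
  apparent_at alpha c p -> apparent_at alpha c q ->
  apparent_at alpha c (a *: p + b *: q).
Proof.
rewrite /apparent_at => hp hq; rewrite !poly.derivE !hornerE.
transitivity (a * (c * p^`().[c] + alpha * p.[c])
  + b * (c * q^`().[c] + alpha * q.[c])); first by rewrite /=; ring.
by rewrite hp hq !mulr0 addr0.
Qed.

Lemma apparent_at_dvd (R : realType) (alpha c : R) (p : {poly R}) :
  ('X - c%:P) ^+ 2 %| p -> apparent_at alpha c p.
Proof.
case/dvdpP => g ->; rewrite /apparent_at !poly.derivE !hornerE /=; ring.
Qed.

(** * The flag spans the invariant spaces *)

Lemma X2_flag_ge4 (R : realType) (alpha : R) (k : nat) : (4 <= k)%N ->
  X2_flag alpha k = ('X - (root_r alpha)%:P) ^+ uphalf k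
    * ('X - (root_s alpha)%:P) ^+ k./2.
Proof. by case: k => [|[|[|[|k]]]]. Qed.

Lemma X2_flag_size (R : realType) (alpha : R) (k : nat) : (2 <= k)%N ->
  size (X2_flag alpha k) = k.+1.
Proof.
move=> k2; have [k4|] := leqP 4 k.
  rewrite X2_flag_ge4 // size_Mmonic ?monic_exp ?monicXsubC //; last first.
    by rewrite expf_neq0 // polyXsubC_eq0.
  by rewrite !size_exp_XsubC addSn addnS /=; have := uphalf_half k;
     have := odd_double_half k; lia.
rewrite /X2_flag; case: k k2 => [|[|[|[|k]]]] //= _ _.
- rewrite -!addrA size_polyDl; first last.
    rewrite size_scale ?invr_eq0 ?pnatr_eq0 //.
    rewrite size_mul ?polyXsubC_eq0 // !size_XsubC -polyCN -polyCN -polyCD.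
    by rewrite size_XaddC.
  by rewrite size_scale ?invr_eq0 ?pnatr_eq0 // size_mul ?polyXsubC_eq0 //
     !size_XsubC.
- have -> : 'X - (root_s alpha)%:P + 1 = 'X - (root_s alpha - 1)%:P.
    by rewrite polyCB polyC1 opprB addrA addrAC.
  by rewrite size_mul ?expf_neq0 ?polyXsubC_eq0 // size_exp_XsubC size_XsubC.
Qed.

(** For most k a double root at c gives the condition at c; what remains is v_2
    at both points and v_3 at s, where it is an identity in t. *)
Lemma X2_flag_space (R : realType) (alpha : R) (k : nat) : 0 < alpha ->
  (2 <= k)%N -> X2_space alpha k (X2_flag alpha k).
Proof.
move=> a0 k2; have [ht _ _] := sqrt_alpha1 _ _ a0.
have ea : alpha = Num.sqrt (alpha + 1) ^+ 2 - 1 by rewrite ht addrK.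
split; first by rewrite X2_flag_size.
- have [k3|] := leqP 3 k.
    apply: apparent_at_dvd; have [k4|k4] := leqP 4 k.
      by rewrite X2_flag_ge4 // dvdp_mulr // dvdp_exp2l // uphalf_half; lia.
    have -> : k = 3 by lia.
    by rewrite /X2_flag /= dvdp_mulr.
  move=> k3; have -> : k = 2 by lia.
  rewrite /apparent_at /X2_flag /= !poly.derivE !hornerE /root_r /root_s /=.
  by move: (Num.sqrt _) ea => t ->; field.
- have [k4|] := leqP 4 k.
    by apply: apparent_at_dvd; rewrite X2_flag_ge4 //
       dvdp_mull // dvdp_exp2l //; lia.
  case: k k2 => [|[|[|[|k]]]] //= _ _;
    rewrite /apparent_at /X2_flag /= !poly.derivE !hornerE /root_r /root_s /=;
    by move: (Num.sqrt _) ea => t ->; field.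
Qed.

(** For p = b x + a, the conditions at r and s differ by
    (s - r)(alpha + 1) b = 0, and b = 0 leaves alpha a = 0. *)
Lemma X2_space1 (R : realType) (alpha : R) (p : {poly R}) : 0 < alpha ->
  X2_space alpha 1 p -> p = 0.
Proof.
move=> a0 [hp hr hs]; have [ht htN t0] := sqrt_alpha1 _ _ a0.
have ep : p = p`_1 *: 'X + (p`_0)%:P.
  apply/polyP => -[|[|i]]; rewrite !coefE /= ?mulr0 ?add0r ?mulr1 ?addr0 //.
  by rewrite nth_default // (leq_trans hp).
move: hr hs; rewrite /apparent_at ep !poly.derivE !hornerE /root_r /root_s /=.
move: (p`_1) (p`_0) => b a hr hs.
have b0 : b = 0.
  apply/eqP; have : 2 * (Num.sqrt (alpha + 1) * (alpha + 1)) * b = 0 by lra.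
  by move/eqP; rewrite mulf_eq0 gt_eqF //; do 2!(apply: mulr_gt0 => //); lra.
move: hr; rewrite b0 !(mulr0, mul0r, add0r, addr0) => /eqP.
by rewrite mulf_eq0 (gt_eqF a0) /= => /eqP ->; rewrite scale0r add0r.
Qed.

(** Induction on k, from the empty sum at k = 1: v_(k+1) cancels the leading
    coefficient of an element of the next space. *)
Lemma span_X2_flag (R : realType) (alpha : R) (k : nat) (p : {poly R}) :
  0 < alpha -> (1 <= k)%N ->
  span_from2 (X2_flag alpha) k p <-> X2_space alpha k p.
Proof.
move=> a0; elim: k p => // -[_|k IH] p _.
  split=> [[c ->]|/(X2_space1 _ _ _ a0) ->].
    by rewrite big_geq // /X2_space /apparent_at size_poly0 deriv0 !horner0
       !mulr0 addr0.
  by exists (fun=> 0); rewrite big_geq.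
have [sv vr vs] := X2_flag_space _ _ k.+2 a0 isT.
split=> [[c ->]|[sp pr ps]].
  rewrite big_nat_recr //=.
  have [|s1 r1 s1'] := (IH (\sum_(2 <= i < k.+2) c i *: X2_flag alpha i) isT).1.
    by exists c.
  rewrite -[X in X + _]scale1r; split; try exact: apparent_at_lin.
  apply: size_add_leq; apply: leq_trans (size_scale_leq _ _) _ => //.
  exact: leqW.
have hsz := X2_flag_size _ alpha k.+2 isT.
have vk0 : (X2_flag alpha k.+2)`_k.+2 != 0.
  have : lead_coef (X2_flag alpha k.+2) != 0.
    by rewrite lead_coef_eq0 -size_poly_eq0 hsz.
  by rewrite lead_coefE hsz.
pose a := p`_k.+2 / (X2_flag alpha k.+2)`_k.+2.
have [|c hc] := (IH (1 *: p + (- a) *: X2_flag alpha k.+2) isT).2.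
  split; try exact: apparent_at_lin.
  apply/leq_sizeP => j; rewrite leq_eqVlt => /predU1P[<-|hj].
    by rewrite coefD !coefZ /a mul1r mulNr divfK // subrr.
  by rewrite coefD !coefZ !nth_default ?mulr0 ?addr0 // (leq_trans _ hj) // hsz.
exists (fun i => if i == k.+2 then a else c i).
rewrite big_nat_recr //= eqxx.
rewrite (eq_big_nat _ _ (F2 := fun i => c i *: X2_flag alpha i)); last first.
  by move=> i /andP[_ hi]; rewrite ltn_eqF.
by rewrite -hc scale1r scaleNr subrK.
Qed.

Theorem lemma3p3 (R : realType) (alpha : R) (halpha : 0 < alpha) :
  X2_flag alpha 2 = laguerre 2 alpha \Po (- 'X) /\
  is_flag [set x | X2_den alpha x != 0] (X2_expr alpha) (X2_flag alpha).
Proof.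
have [ht _ _] := sqrt_alpha1 _ _ halpha.
split.
  rewrite laguerre2_oppX /X2_flag /= /root_r /root_s.
  move: (Num.sqrt _) ht => t ht.
  have -> : alpha = t ^+ 2 - 1 by rewrite ht addrK.
  rewrite -!mul_polyC.
  have -> : ((t ^+ 2 - 1 + 1) * (t ^+ 2 - 1 + 2) / 2)%:P =
    (2^-1)%:P * ((t ^+ 2)%:P * (t ^+ 2 + 1)%:P) :> {poly R}.
    by rewrite -!polyCM; congr (_%:P); field.
  apply/eqP; rewrite -subr_eq0; apply/eqP.
  (* The two sides agree up to the relation (1/2) * 2 = 1 in {poly R}. *)
  transitivity (((2^-1)%:P * 2 - 1) * ((t ^+ 2)%:P * ('X - 1))); first by ring.
  by rewrite half_polyC subrr mul0r.
split=> [k k2|k k2 p]; first exact: X2_flag_size.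
move/(span_X2_flag _ _ _ _ halpha (ltnW k2)) => hp.
have [w hw hwq] := X2_space_stable _ _ _ _ halpha hp.
exists w; first by apply/(span_X2_flag _ _ _ _ halpha (ltnW k2)).
move=> x /= q0; rewrite X2_exprE // -hwq hornerM mulfK //.
by move: q0; rewrite X2_denE.
Qed.
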